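(* Let $T$ be a Lie triple system over a field $\mathbb{F}$ with $\mathrm{Z}(T)=\{0\}$. Let $U$ be a subspace of $T$ with $T=U\oplus[T,T,T]$ (direct sum of vector spaces), let $\breve{T}=Tt+Tt^{3}=Tt+Ut^{3}+[T,T,T]t^{3}$ be the associated Lie triple system, and let $\varphi:\mathrm{QDer}(T)\to\mathrm{End}(\breve{T})$ be given by $$\varphi(D)(at+ut^{3}+bt^{3})=D(a)t+D'(b)t^{3}\qquad(a\in T,\ u\in U,\ b\in[T,T,T]),$$ where $D'\in\mathrm{End}(T)$ is any map with $[D(x),y,z]+[x,D(y),z]+[x,y,D(z)]=D'([x,y,z])$ for all $x,y,z\in T$. Then $$\mathrm{Der}(\breve{T})=\varphi(\mathrm{QDer}(T))\dotplus\mathrm{ZDer}(\breve{T}),$$ where $\dotplus$ denotes the direct sum of vector spaces.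
   Context: A Lie triple system over a field $\mathbb{F}$ is a vector space $T$ over $\mathbb{F}$ with a trilinear map $[\cdot,\cdot,\cdot]:T\times T\times T\to T$ such that for all $x,y,z,u,v\in T$: $[x,x,z]=0$; $[x,y,z]+[y,z,x]+[z,x,y]=0$; $[x,y,[z,u,v]]=[[x,y,z],u,v]+[z,[x,y,u],v]+[z,u,[x,y,v]]$. $\mathrm{End}(T)$ is the set of all linear maps $T\to T$. $[T,T,T]$ is the linear span of all $[x,y,z]$. The center is $\mathrm{Z}(T)=\{x\in T\mid [x,y,z]=0\ \forall y,z\in T\}$. $\mathrm{Der}(T)$ is the set of $D\in\mathrm{End}(T)$ with $[D(x),y,z]+[x,D(y),z]+[x,y,D(z)]=D([x,y,z])$ for all $x,y,z\in T$. $\mathrm{ZDer}(T)$ is the set of $D\in\mathrm{End}(T)$ with $[D(x),y,z]=D([x,y,z])=0$ for all $x,y,z\in T$. $\mathrm{QDer}(T)$ is the set of $D\in\mathrm{End}(T)$ for which there exists $D'\in\mathrm{End}(T)$ with $[D(x),y,z]+[x,D(y),z]+[x,y,D(z)]=D'([x,y,z])$ for all $x,y,z\in T$. For an indeterminate $t$, $\breve{T}=\{x\otimes t+y\otimes t^{3}\mid x,y\in T\}$, with $xt^i$ written for $x\otimes t^i$. It is a Lie triple system with the trilinear bracket determined by $[xt^{i},yt^{j},zt^{k}]=[x,y,z]t^{i+j+k}$ for $x,y,z\in T$ and $i,j,k\in\{1,3\}$, where $t^{m}$ is taken to be $0$ for $m\geq 4$. The map $\varphi(D)$ does not depend on the choice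 of $D'$. *)

(* Defs.v *)
From HB Require Import structures.
From mathcomp Require Import all_boot all_order all_algebra.
From mathcomp Require Import all_classical.

Set Implicit Arguments.
Unset Strict Implicit.
Unset Printing Implicit Defensive.

Import GRing.Theory.
Local Open Scope classical_set_scope.
Local Open Scope ring_scope.

(* No finite dimensionality anywhere: subspaces are classical sets, and linear
   maps are plain functions, so that End(T) is a set in the library's pointwise
   F-vector space T -> T. *)

HB.mixin Record Lmodule_isLieTriple (F : fieldType) T of GRing.Lmodule F T := {
  bra : T -> T -> T -> T;
  bra_linear1 : forall y z, linear (fun x => bra x y z);
  bra_linear2 : forall x z, linear (fun y => bra x y z);
  bra_linear3 : forall x y, linear (fun z => bra x y z);
  braxx : forall x z, bra x x z = 0;
  bra_cyclic : forall x y z, bra x y z + bra y z x + bra z x y = 0;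
  bra_der : forall x y z u v,
    bra x y (bra z u v) =
      bra (bra x y z) u v + bra z (bra x y u) v + bra z u (bra x y v)
}.

#[short(type="lieTripleType")]
HB.structure Definition LieTriple (F : fieldType) :=
  {T of GRing.Lmodule F T & Lmodule_isLieTriple F T}.

Section VectorSpace.
Variables (F : fieldType) (V : lmodType F).

Definition lspan (G : set V) : set V :=
  smallest (fun A : set V => submod_closed (mem A)) G.

Definition direct_sum (W A B : set V) : Prop :=
  [/\ submod_closed (mem A), submod_closed (mem B),
      W = [set a + b | a in A & b in B] & A `&` B = [set 0]].

Definition End : set (V -> V) := [set D | linear D].

End VectorSpace.
Arguments End {F} V.

Section LieTripleTheory.
Variables (F : fieldType) (T : lieTripleType F).

Definition bra_image : set T :=
  [set w | exists x, exists y, exists z, w = bra x y z].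

(* [T, T, T] *)
Definition TTT : set T := lspan bra_image.

Definition center : set T := [set x | forall y z : T, bra x y z = 0].

Definition quasi (D D' : T -> T) : Prop :=
  forall x y z, bra (D x) y z + bra x (D y) z + bra x y (D z) = D' (bra x y z).

Definition Der : set (T -> T) := [set D | End T D /\ quasi D D].

Definition QDer : set (T -> T) :=
  [set D | End T D /\ exists D', End T D' /\ quasi D D'].

Definition ZDer : set (T -> T) :=
  [set D | End T D /\
    forall x y z, bra (D x) y z = 0 /\ D (bra x y z) = 0].

(* The pair (x, y) stands for x t + y t^3. *)
Definition breve : Type := (T * T)%type.
HB.instance Definition _ := GRing.Lmodule.on breve.

(* x t^i, with t^i = 0 for i >= 4; only i = 1, 3 and i >= 4 are meaningful. *)
Definition tmon (x : T) (i : nat) : breve :=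
  if i == 1%N then (x, 0) else if i == 3%N then (0, x) else 0.

Definition tcoef (X : breve) (i : nat) : T :=
  if i == 1%N then X.1 else if i == 3%N then X.2 else 0.

Definition breve_bra (X Y Z : breve) : breve :=
  \sum_(i <- [:: 1; 3]%N) \sum_(j <- [:: 1; 3]%N) \sum_(k <- [:: 1; 3]%N)
    tmon (bra (tcoef X i) (tcoef Y j) (tcoef Z k)) (i + j + k).

Lemma breve_braE X Y Z : breve_bra X Y Z = (0, bra X.1 Y.1 Z.1).
Proof.
by rewrite /breve_bra !big_cons !big_nil /tmon /tcoef /= !addr0.
Qed.

Lemma bra0l (y z : T) : bra 0 y z = 0.
Proof.
by have := bra_linear1 y z (-1) 0 0; rewrite scaler0 addr0 scaleN1r addNr.
Qed.

Lemma bra0m (x z : T) : bra x 0 z = 0.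
Proof.
by have := bra_linear2 x z (-1) 0 0; rewrite scaler0 addr0 scaleN1r addNr.
Qed.

Lemma bra0r (x y : T) : bra x y 0 = 0.
Proof.
by have := bra_linear3 x y (-1) 0 0; rewrite scaler0 addr0 scaleN1r addNr.
Qed.

Lemma breve_linear_aux (c : F) (u v : T) :
  (0, c *: u + v) = c *: ((0, u) : breve) + (0, v).
Proof. by congr (_, _); rewrite /= scaler0 addr0. Qed.

Fact breve_linear1 Y Z : linear (fun X => breve_bra X Y Z).
Proof.
by move=> c X X'; rewrite !breve_braE -breve_linear_aux bra_linear1.
Qed.

Fact breve_linear2 X Z : linear (fun Y => breve_bra X Y Z).
Proof.
by move=> c Y Y'; rewrite !breve_braE -breve_linear_aux bra_linear2.
Qed.

Fact breve_linear3 X Y : linear (fun Z => breve_bra X Y Z).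
Proof.
by move=> c Z Z'; rewrite !breve_braE -breve_linear_aux bra_linear3.
Qed.

Fact breve_braxx X Z : breve_bra X X Z = 0.
Proof. by rewrite breve_braE braxx. Qed.

Fact breve_bra_cyclic X Y Z :
  breve_bra X Y Z + breve_bra Y Z X + breve_bra Z X Y = 0.
Proof. by rewrite !breve_braE; congr (_, _); rewrite /= ?addr0 ?bra_cyclic. Qed.

Fact breve_bra_der X Y Z U V :
  breve_bra X Y (breve_bra Z U V) =
    breve_bra (breve_bra X Y Z) U V + breve_bra Z (breve_bra X Y U) V +
    breve_bra Z U (breve_bra X Y V).
Proof.
rewrite !breve_braE /= bra0l bra0m !bra0r.
by congr (_, _); rewrite /= !addr0.
Qed.

HB.instance Definition _ := Lmodule_isLieTriple.Build F breve
  breve_linear1 breve_linear2 breve_linear3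
  breve_braxx breve_bra_cyclic breve_bra_der.

(* Some D' in End(T) associated with D, and the component of x in [T, T, T]
   along U; the map phi below is characterized by phiE. *)
Definition qder_assoc (D : T -> T) : T -> T :=
  xget 0 [set D' | End T D' /\ quasi D D'].

Definition TTT_part (U : set T) (x : T) : T :=
  xget 0 [set b | TTT b /\ exists2 u, U u & x = u + b].

Definition phi (U : set T) (D : T -> T) : breve -> breve :=
  fun X => tmon (D (tcoef X 1)) 1
           + tmon (qder_assoc D (TTT_part U (tcoef X 3))) 3.

Lemma quasi_TTT (D D1 D2 : T -> T) : End T D1 -> End T D2 ->
  quasi D D1 -> quasi D D2 -> forall b, TTT b -> D1 b = D2 b.
Proof.
move=> l1 l2 q1 q2 b Tb; apply: (Tb [set b | D1 b = D2 b]); split.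
  have D0 (E : T -> T) : End T E -> E 0 = 0.
    by move=> /(_ (-1) 0 0); rewrite scaler0 addr0 scaleN1r addNr.
  split; first by rewrite inE /= !D0.
  by move=> c x y; rewrite !inE /= l1 l2 => -> ->.
by move=> _ [x [y [z ->]]] /=; rewrite -q1 -q2.
Qed.

Lemma TTT_partE (U : set T) : direct_sum [set: T] U TTT ->
  forall u b, U u -> TTT b -> TTT_part U (u + b) = b.
Proof.
move=> [Us Ts _ UT0] u b Uu Tb; apply: xget_unique; first by split => //; exists u.
move=> c [Tc [v Uv e]].
have /GRing.submod_closedB [_ UB] := Us; have /GRing.submod_closedB [_ TB] := Ts.
have ebc : c - b = u - v.
  by apply/eqP; rewrite subr_eq addrAC eq_sym subr_eq addrC [c + v]addrC -e addrC.
suff : (U `&` TTT) (c - b) by rewrite UT0 => /eqP; rewrite subr_eq0 => /eqP.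
split; last by apply/set_mem/TB; apply/mem_set.
by rewrite ebc; apply/set_mem/UB; apply/mem_set.
Qed.

Lemma phiE (U : set T) (D D' : T -> T) : direct_sum [set: T] U TTT ->
  End T D -> End T D' -> quasi D D' ->
  forall a u b, U u -> TTT b ->
    phi U D (tmon a 1 + tmon u 3 + tmon b 3) = tmon (D a) 1 + tmon (D' b) 3.
Proof.
move=> UT lD lD' q a u b Uu Tb; rewrite /phi /tcoef /=.
rewrite !addr0 add0r TTT_partE //; congr (_ + tmon _ _).
have [l' q'] : (End T `&` quasi D) (qder_assoc D).
  by apply: (@xgetPex _ 0 [set D' | End T D' /\ quasi D D']); exists D'.
exact: (quasi_TTT l' lD' q' q).
Qed.

End LieTripleTheory.
Arguments TTT {F} T.
Arguments center {F} T.
Arguments Der {F} T.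
Arguments QDer {F} T.
Arguments ZDer {F} T.

(* Main.v *)
Require Import Defs.
From mathcomp Require Import all_boot all_order all_algebra.
From mathcomp Require Import all_classical.

Import GRing.Theory.
Local Open Scope classical_set_scope.
Local Open Scope ring_scope.

(** A linear map [E] of [T t + T t^3] is a 2 x 2 matrix of linear maps of [T],
    [E (a, b) = (p a + q b, r a + s b)], and the bracket reads only first
    components and lands in the second one. The derivation identity on triples
    with a vector [(0, x)] in the first slot puts [q x] in the center, so
    [q = 0]. On triples with second components
    zero it then says exactly that [p] is a quasiderivation with associated map
    [s] ([breve_derivation_quasi]). So [phi U p] is defined, and [E - phi U p]
    has zero first component and kills every bracket, since [s] and the map
    chosen in [phi] agree on [[T, T, T]]: it is a central derivation
    ([breve_derivation_decomposition]).

    Conversely [phi U D] is a derivation ([phi_Der]) and central derivations are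
    derivations ([ZDer_Der]). The sum is direct because centrality of [phi U D]
    forces [D] to take values in the center, so [D = 0] and [phi U D = 0]
    ([phi_ZDer_eq0]). *)

Section LinearMaps.
Context {F : fieldType} {V : lmodType F}.
Implicit Types (A B : set V) (D E : V -> V).

Lemma End0 D : End V D -> D 0 = 0.
Proof. by move=> /(_ (-1) 0 0); rewrite scaler0 addr0 scaleN1r addNr. Qed.

Lemma EndD D : End V D -> {morph D : x y / x + y}.
Proof. by move=> lD x y; have := lD 1 x y; rewrite !scale1r. Qed.

Lemma End_lin c D E : End V D -> End V E -> End V (c *: D + E).
Proof.
move=> lD lE k x y; rewrite -[(_ + _) _]/(c *: D _ + E _) lD lE.
rewrite -[(c *: D + E) x]/(c *: D x + E x) -[(c *: D + E) y]/(c *: D y + E y).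
by rewrite !scalerDr !scalerA (mulrC c k) addrACA.
Qed.

Lemma submod_closed_setP A :
  A 0 -> (forall c x y, A x -> A y -> A (c *: x + y)) -> submod_closed (mem A).
Proof.
move=> A0 Alin; split; first by rewrite inE.
by move=> c x y; rewrite !inE; apply: Alin.
Qed.

Lemma submod_closed_lin A c x y :
  submod_closed (mem A) -> A x -> A y -> A (c *: x + y).
Proof.
move=> [_ /(_ c x y)]; rewrite !inE => Alin Ax Ay; exact: Alin.
Qed.

End LinearMaps.

Section Quasiderivations.
Context {F : fieldType} {T : lieTripleType F}.
Implicit Types (D E : T -> T) (U : set T).

Lemma braDl (x x' y z : T) : bra (x + x') y z = bra x y z + bra x' y z.
Proof. by have := bra_linear1 y z 1 x x'; rewrite !scale1r. Qed.

Lemma braDm (x y y' z : T) : bra x (y + y') z = bra x y z + bra x y' z.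
Proof. by have := bra_linear2 x z 1 y y'; rewrite !scale1r. Qed.

Lemma bra_anti (x y z : T) : bra x y z = - bra y x z.
Proof.
have := braxx (x + y) z; rewrite braDl !braDm !braxx add0r addr0.
by move/eqP; rewrite addr_eq0 => /eqP.
Qed.

(** Skew-symmetry and the cyclic identity move a central element from any slot
    to the first one. *)
Lemma bra_center (w y z : T) : center T w ->
  [/\ bra w y z = 0, bra y w z = 0 & bra y z w = 0].
Proof.
move=> cw; split; first exact: cw.
  by rewrite bra_anti cw oppr0.
by have := bra_cyclic y z w; rewrite (bra_anti z) !cw oppr0 !addr0.
Qed.

Lemma ZDer_Der : ZDer T `<=` Der T.
Proof.
move=> D [lD zD]; split=> // x y z.
have cD w : center T (D w) by move=> a b; have [] := zD w a b.
have [-> _ _] := bra_center _ y z (cD x).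
have [_ -> _] := bra_center _ x z (cD y).
have [_ _ ->] := bra_center _ x y (cD z).
by have [_ ->] := zD x y z; rewrite !addr0.
Qed.

Lemma quasi_lin c D D' E E' :
  quasi D D' -> quasi E E' -> quasi (c *: D + E) (c *: D' + E').
Proof.
move=> qD qE x y z.
rewrite -[RHS]/(c *: D' _ + E' _) -qD -qE.
rewrite -[(c *: D + E) x]/(c *: D x + E x) -[(c *: D + E) y]/(c *: D y + E y).
rewrite -[(c *: D + E) z]/(c *: D z + E z) bra_linear1 bra_linear2 bra_linear3.
by rewrite !scalerDr [RHS]addrACA; congr (_ + _); apply: addrACA.
Qed.

Lemma quasi0 : @quasi F T 0 0.
Proof. by move=> x y z; rewrite bra0l bra0m bra0r !addr0. Qed.

Lemma End_zero : End T 0.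
Proof. by move=> c x y; rewrite scaler0 addr0. Qed.

Lemma ZDer_submod : submod_closed (mem (ZDer T)).
Proof.
apply: submod_closed_setP => [|c D E [lD zD] [lE zE]].
  by split=> [|x y z]; [exact: End_zero | rewrite bra0l].
split=> [|x y z]; first exact: End_lin.
have [Dx Dxyz] := zD x y z; have [Ex Exyz] := zE x y z.
rewrite -[(_ + _) x]/(c *: D x + E x) -[(_ + _) (bra _ _ _)]/(c *: D _ + E _).
by rewrite bra_linear1 Dx Ex Dxyz Exyz scaler0 addr0.
Qed.

Lemma bra_breve (X Y Z : breve T) :
  bra X Y Z = (0, bra X.1 Y.1 Z.1) :> breve T.
Proof. exact: breve_braE. Qed.

Lemma TTT_bra (x y z : T) : TTT T (bra x y z).
Proof. by move=> A [_]; apply; exists x, y, z. Qed.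

Section Complement.
Variable U : set T.
Hypothesis UT : direct_sum [set: T] U (TTT T).

Lemma TTT_partP x : exists2 u, U u & x = u + TTT_part U x.
Proof.
have [_ _ UTT _] := UT; have : [set: T] x by [].
by rewrite UTT => -[u Uu [b Tb <-]]; exists u; rewrite ?(TTT_partE UT).
Qed.

Lemma TTT_part_TTT x : TTT T (TTT_part U x).
Proof.
have [_ _ UTT _] := UT; have : [set: T] x by [].
by rewrite UTT => -[u Uu [b Tb <-]]; rewrite (TTT_partE UT).
Qed.

Lemma TTT_part_id b : TTT T b -> TTT_part U b = b.
Proof.
have [[U0 _] _ _ _] := UT; rewrite inE in U0 => Tb.
by rewrite -[in LHS](add0r b) (TTT_partE UT).
Qed.

Lemma TTT_part_linear : End T (TTT_part U).
Proof.
have [sU sT _ _] := UT; move=> c x y.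
have [u Uu ex] := TTT_partP x; have [v Uv ey] := TTT_partP y.
rewrite [in LHS]ex [in LHS]ey scalerDr addrACA (TTT_partE UT) //.
  exact: submod_closed_lin.
by apply: (submod_closed_lin (TTT T)) => //; apply: TTT_part_TTT.
Qed.

(** Maps associated with one quasiderivation agree on [T, T, T], so any of them
    computes [phi]; linearity of [phi] in [D] follows by using the matching
    linear combination of associated maps. *)
Lemma phi_pair D D' (X : breve T) : End T D' -> quasi D D' ->
  phi U D X = (D X.1, D' (TTT_part U X.2)).
Proof.
move=> lD' qD; rewrite /phi /tmon /tcoef /=.
have [l' q'] : (End T `&` quasi D) (qder_assoc D).
  by apply: (@xgetPex _ 0 [set D' | End T D' /\ quasi D D']); exists D'.
rewrite (quasi_TTT l' lD' q' qD (TTT_part_TTT _)).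
by congr (_, _); rewrite /= ?addr0 ?add0r.
Qed.

Lemma phi_Der D : QDer T D -> Der (breve T) (phi U D).
Proof.
move=> [lD [D' [lD' qD]]]; split=> [c X Y|X Y Z]; rewrite !(phi_pair _ _ _ lD' qD).
  by congr (_, _); rewrite /= ?lD // TTT_part_linear lD'.
rewrite !bra_breve /= (End0 _ lD).
rewrite TTT_part_id; last exact: TTT_bra.
by rewrite -qD; congr (_, _); rewrite /= !addr0.
Qed.

Lemma phi_lin c D E : QDer T D -> QDer T E ->
  phi U (c *: D + E) = c *: phi U D + phi U E.
Proof.
move=> [lD [D' [lD' qD]]] [lE [E' [lE' qE]]]; apply/funext => X.
rewrite -[RHS]/(c *: phi U D X + phi U E X).
rewrite (phi_pair _ _ _ (End_lin c _ _ lD' lE') (quasi_lin c _ _ _ _ qD qE)).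
by rewrite (phi_pair _ _ _ lD' qD) (phi_pair _ _ _ lE' qE).
Qed.

Lemma phi0 : phi U 0 = 0.
Proof.
by apply/funext => X; rewrite (phi_pair _ _ _ End_zero quasi0).
Qed.

Lemma QDer_lin c D E : QDer T D -> QDer T E -> QDer T (c *: D + E).
Proof.
move=> [lD [D' [lD' qD]]] [lE [E' [lE' qE]]]; split; first exact: End_lin.
by exists (c *: D' + E'); split; [exact: End_lin | exact: quasi_lin].
Qed.

Lemma QDer0 : QDer T 0.
Proof. by split; [|exists 0; split; [|exact: quasi0]]; exact: End_zero. Qed.

Lemma phi_QDer_submod : submod_closed (mem (phi U @` QDer T)).
Proof.
apply: submod_closed_setP => [|c _ _ [D qD <-] [E qE <-]].
  by exists 0; [exact: QDer0 | exact: phi0].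
by exists (c *: D + E); [exact: QDer_lin | exact: phi_lin].
Qed.

Hypothesis ZT0 : center T = [set 0].

(** Bracketing [phi U D (x, 0)] with elements of degree 1 in [t] shows that
    [D x] is central. *)
Lemma phi_ZDer_eq0 D : QDer T D -> ZDer (breve T) (phi U D) -> phi U D = 0.
Proof.
move=> [lD [D' [lD' qD]]] [_ zD]; suff -> : D = 0 by exact: phi0.
apply/funext => x; suff : center T (D x) by rewrite ZT0.
move=> y z; have [+ _] := zD (x, 0) (y, 0) (z, 0).
by rewrite (phi_pair _ _ _ lD' qD) bra_breve /= => -[].
Qed.

(** Since brackets have zero first component, only the first components of [E]
    enter the derivation identity on its left, and only [s] on its right, where
    the second component of the identity is read. *)
Lemma breve_derivation_quasi (E : breve T -> breve T) : Der (breve T) E ->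
  let p x := (E (x, 0)).1 in let s x := (E (0, x)).2 in
  [/\ End T p, End T s, quasi p s & forall x, (E (0, x)).1 = 0].
Proof.
move=> [lE qE] p s.
have fst_lin c (X Y : breve T) : (c *: X + Y).1 = c *: X.1 + Y.1 by [].
have snd_lin c (X Y : breve T) : (c *: X + Y).2 = c *: X.2 + Y.2 by [].
have lp : End T p.
  move=> c x y; rewrite /p -fst_lin -lE; congr (E _).1.
  by congr (_, _); rewrite /= scaler0 addr0.
have ls : End T s.
  by move=> c x y; rewrite /s -snd_lin -lE breve_linear_aux.
have qsnd (X Y Z : breve T) : bra (E X).1 Y.1 Z.1 + bra X.1 (E Y).1 Z.1
    + bra X.1 Y.1 (E Z).1 = s (bra X.1 Y.1 Z.1).
  by have := qE X Y Z; rewrite !bra_breve => /(congr1 snd).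
split=> // [x y z|x]; first exact: (qsnd (x, 0) (y, 0) (z, 0)).
suff : center T (E (0, x)).1 by rewrite ZT0.
move=> y z; have := qsnd (0, x) (y, 0) (z, 0).
by rewrite /= !bra0l !addr0 (End0 _ ls).
Qed.

(** The difference has zero first component, hence central values; on brackets
    its second component is [s - s], as [phi] may be computed with [s]. *)
Lemma breve_derivation_decomposition (E : breve T -> breve T) :
  Der (breve T) E ->
  exists2 D, QDer T D & ZDer (breve T) (E - phi U D).
Proof.
move=> dE; have [lp ls q E01] := breve_derivation_quasi _ dE.
set p := fun x => (E (x, 0)).1 in lp q; set s := fun x => (E (0, x)).2 in ls q.
have qp : QDer T p by split=> //; exists s.
exists p => //; have [lE _] := dE; have [lphi _] := phi_Der _ qp.
have subE X : (E - phi U p) X = E X - phi U p X by [].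
split=> [|X Y Z].
  by have := End_lin (-1) _ _ lphi lE; rewrite scaleN1r addrC.
rewrite !subE !(phi_pair _ _ _ ls q); split.
  rewrite bra_breve /=.
  have -> : (E X).1 = p X.1.
    have -> : X = (X.1, 0) + ((0, X.2) : breve T).
      by case: X => a b; congr (_, _); rewrite /= ?addr0 ?add0r.
    by rewrite (EndD _ lE) /= E01 !addr0.
  by rewrite subrr bra0l.
rewrite bra_breve /= (TTT_part_id _ (TTT_bra _ _ _)) (End0 _ lp).
by congr (_, _); rewrite /= ?E01 subrr.
Qed.

End Complement.
End Quasiderivations.

Theorem proposition4p3 (F : fieldType) (T : lieTripleType F) (U : set T)
    (ZT0 : center T = [set 0]) (UT : direct_sum [set: T] U (TTT T)) :
  direct_sum (Der (breve T)) (phi U @` QDer T) (ZDer (breve T)).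
Proof.
split; [exact: phi_QDer_submod | exact: ZDer_submod | |].
- apply/seteqP; split=> [E dE|_ [_ [D qD <-]] [E zE <-]].
    have [D qD zE] := breve_derivation_decomposition _ UT ZT0 _ dE.
    exists (phi U D); first by exists D.
    by exists (E - phi U D); rewrite // addrC subrK.
  have [l1 q1] := phi_Der _ UT _ qD; have [l2 q2] := ZDer_Der _ zE.
  rewrite -[phi U D]scale1r; split; first exact: End_lin.
  exact: quasi_lin.
- apply/seteqP; split=> [_ [[D qD <-] zD]|_ ->].
    exact: phi_ZDer_eq0 UT ZT0 D qD zD.
  split; first by exists 0; [exact: QDer0 | exact: phi0].
  by have [+ _] := ZDer_submod (T := breve T); rewrite inE.
Qed.
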